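(* Let $x=(x_1,\ldots,x_n)$ and $\lambda=(\lambda_1,\ldots,\lambda_r)$. Let $F(x,\lambda)=F_0(x)+\sum_{k=1}^r\lambda_kF_k(x)$ be a symmetric $p\times p$ polynomial matrix and, for $i=1,\ldots,m$, let $G_i(x,\lambda)=G_{i0}(x)+\sum_{k=1}^r\lambda_kG_{ik}(x)$ be a symmetric $q_i\times q_i$ polynomial matrix. Suppose that the restricted matrix quadratic module $\mathfrak M_x^p(G)$ is restricted Archimedean and that there is $\varepsilon>0$ such that $$F(x,A)\succeq\varepsilon I_{pq}$$ for every integer $q\ge1$, every $x\in\mathbb R^n$, and every tuple $A=(A_1,\ldots,A_r)$ of real symmetric $q\times q$ matrices satisfying $G_i(x,A)\succeq 0$ for all $i=1,\ldots,m$. Then $F\in\mathfrak M_x^p(G)$.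
   Context: For $x\in\mathbb R^n$ and a tuple $A=(A_1,\ldots,A_r)$ of real symmetric $q\times q$ matrices, $G_i(x,A)=G_{i0}(x)\otimes I_q+\sum_{k=1}^rG_{ik}(x)\otimes A_k$ and $F(x,A)=F_0(x)\otimes I_q+\sum_{k=1}^rF_k(x)\otimes A_k$ (Kronecker products). $\mathcal V_r=\{p_0(x)+\sum_{k=1}^r\lambda_kp_k(x):p_k\in\mathbb R[x]\}$. $\mathbb S^p$ is the space of real symmetric $p\times p$ matrices, and $\mathbb S^p\otimes\mathcal V_r$ is the space of symmetric $p\times p$ polynomial matrices with entries in $\mathcal V_r$. $\Sigma^p[x]$ is the cone of SOS polynomial matrices: $S\in\Sigma^p[x]$ if $S=P^{\intercal}P$ for some polynomial matrix $P$ in $x$ with $p$ columns. The restricted matrix quadratic module is $$\mathfrak M_x^p(G)=\Big\{S_0+\sum_{i=1}^m\sum_\nu H_{i\nu}^{\intercal}G_iH_{i\nu}: S_0\in\Sigma^p[x],\ H_{i\nu}\in\mathbb R[x]^{q_i\times p}\Big\}\subseteq\mathbb S^p\otimes\mathcal V_r,$$ where the sums over $\nu$ are finite. It is restricted Archimedean if $I_p$ is an order unit in $\mathbb S^p\otimes\mathcal V_r$: for every $P\in\mathbb S^p\otimes\mathcal V_r$ there is $N>0$ with $NI_p+P,\ NI_p-P\in\mathfrak M_x^p(G)$. *)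

(* Defs.v *)
From mathcomp Require Import all_boot all_order all_algebra.
From mathcomp Require Import mxtens mpoly.
From mathcomp Require Import reals.

Set Implicit Arguments.
Unset Strict Implicit.
Unset Printing Implicit Defensive.

Import GRing.Theory Num.Theory.
Local Open Scope ring_scope.

(* R[x] with x = (x_1, ..., x_n). *)
Notation polyx R n := (mpoly n R) (only parsing).

(* R[x, lambda], realised as R[x][lambda_1, ..., lambda_r]. *)
Notation polyxl R n r := (mpoly r (mpoly n R)) (only parsing).

Section RestrictedQuadraticModule.

Variable R : realType.

Definition psd (d : nat) (M : 'M[R]_d) : Prop :=
  M^T = M /\ forall v : 'cV[R]_d, 0 <= (v^T *m M *m v) ord0 ord0.

Definition loewner_le (d : nat) (M N : 'M[R]_d) : Prop := psd (N - M).

Variables n r : nat.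

Definition lift_mx (a b : nat) (M : 'M[polyx R n]_(a, b)) :
    'M[polyxl R n r]_(a, b) :=
  map_mx (@mpolyC r (polyx R n)) M.

Definition lambda (k : 'I_r) : polyxl R n r := 'X_k.

Definition pencil (d : nat) (F0 : 'M[polyx R n]_d) (F : 'I_r -> 'M[polyx R n]_d) :
    'M[polyxl R n r]_d :=
  lift_mx F0 + \sum_(k < r) lambda k *: lift_mx (F k).

Definition eval_mx (d : nat) (x : 'I_n -> R) (M : 'M[polyx R n]_d) : 'M[R]_d :=
  map_mx (meval x) M.

(* The coefficients are arguments here because the A_k need not commute, so this
   is not a polynomial evaluation; they are determined by [pencil F0 F]. *)
Definition pencil_eval (d : nat) (F0 : 'M[polyx R n]_d)
    (F : 'I_r -> 'M[polyx R n]_d) (s : nat) (x : 'I_n -> R)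
    (A : 'I_r -> 'M[R]_s) : 'M[R]_(d * s) :=
  tensmx (eval_mx x F0) (1%:M : 'M[R]_s) +
    \sum_(k < r) tensmx (eval_mx x (F k)) (A k).

Definition in_V (f : polyxl R n r) : Prop :=
  exists (p0 : polyx R n) (p : 'I_r -> polyx R n),
    f = mpolyC r p0 + \sum_(k < r) lambda k * mpolyC r (p k).

Definition in_SV (p : nat) (P : 'M[polyxl R n r]_p) : Prop :=
  P^T = P /\ forall i j, in_V (P i j).

Definition sos_mx (p : nat) (S : 'M[polyx R n]_p) : Prop :=
  exists (t : nat) (P : 'M[polyx R n]_(t, p)), S = P^T *m P.

Definition qmodule (m : nat) (q : 'I_m -> nat)
    (G : forall i : 'I_m, 'M[polyxl R n r]_(q i)) (p : nat)
    (Q : 'M[polyxl R n r]_p) : Prop :=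
  exists (S0 : 'M[polyx R n]_p) (N : 'I_m -> nat)
         (H : forall i : 'I_m, 'I_(N i) -> 'M[polyx R n]_(q i, p)),
    sos_mx S0 /\
    Q = lift_mx S0 +
        \sum_(i < m) \sum_(nu < N i)
          (lift_mx (H i nu))^T *m G i *m lift_mx (H i nu).

(* [c%:M] with [c] a real constant seen in R[x][lambda] is [c I_p]. *)
Definition restricted_archimedean (m : nat) (q : 'I_m -> nat)
    (G : forall i : 'I_m, 'M[polyxl R n r]_(q i)) (p : nat) : Prop :=
  forall P : 'M[polyxl R n r]_p, in_SV P ->
    exists c : R, [/\ 0 < c,
      qmodule G ((mpolyC r (mpolyC n c))%:M + P) &
      qmodule G ((mpolyC r (mpolyC n c))%:M - P)].

End RestrictedQuadraticModule.

(* Main.v *)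
Require Import Defs.
From mathcomp Require Import all_boot all_order all_algebra.
From mathcomp Require Import mxtens mpoly.
From mathcomp Require Import reals zify ring lra.
From mathcomp Require boolp classical_sets.

(* Suppose F is not in the module M. Jacobi's descent shows that the cone generated by
   M and the multiples - s F, with s a sum of squares in R[x], is still proper; a maximal
   proper cone above it that is stable under multiplication by squares of R[x] is total,
   so it defines a functional L that is nonnegative on M, with L(I) = 1 and L(F) <= 0.
   Totality makes L(a P) = L(a I) L(P) for a in R[x], hence L is evaluation at a point x
   followed by a functional (P_0, P_k) |-> tr(P_0 B_0) + sum_k tr(P_k B_k) on constant
   matrices. The Archimedean hypothesis, moved by congruences, bounds every B_k by a
   multiple of B_0 >= 0; writing B_0 = C C^T with C of full column rank this gives
   B_k = C A_k C^T with A_k symmetric. Nonnegativity of L on H^T G_i H is exactly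
   G_i(x, A) >= 0, whereas L(F) is the value at vec C of the quadratic form of F(x, A),
   so L(F) >= eps |C|^2 = eps tr(B_0) = eps > 0, a contradiction. *)

Set Implicit Arguments.
Unset Strict Implicit.
Unset Printing Implicit Defensive.

Import Order.TTheory GRing.Theory Num.Theory.
Local Open Scope ring_scope.

Lemma trmxD (S : zmodType) a b (X Y : 'M[S]_(a, b)) : (X + Y)^T = X^T + Y^T.
Proof. exact: raddfD. Qed.

Lemma trmxZ (S : pzRingType) a b (c : S) (X : 'M[S]_(a, b)) : (c *: X)^T = c *: X^T.
Proof. exact: linearZ. Qed.

Lemma trmxN (S : zmodType) a b (X : 'M[S]_(a, b)) : (- X)^T = - X^T.
Proof. exact: raddfN. Qed.

(** * Quadratic cones over a commutative algebra *)

Lemma ge0_of_le_small (R : realType) (a b : R) :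
  0 <= b -> (forall d, 0 < d -> 0 <= a + d * b) -> 0 <= a.
Proof.
move=> b0 H; rewrite leNgt; apply/negP => a0.
have b1 : 0 < b + 1 by lra.
have := H (- a / (b + 1)) ltac:(by apply: divr_gt0; lra).
have -> : - a / (b + 1) * b = - a * (b / (b + 1)) by field; lra.
suff : b / (b + 1) < 1 by nra.
by rewrite ltr_pdivrMr //; lra.
Qed.

Lemma eq0_of_natmul_le (R : realType) (a b : R) :
  (forall k : nat, - b <= k%:R * a <= b) -> a = 0.
Proof.
move=> H; apply/eqP; rewrite -normr_eq0; apply/eqP.
have [//|a0] : `|a| = 0 \/ 0 < `|a|.
  by case: (ltrP 0 `|a|) (normr_ge0 a) => h1 h2; [right|left; lra].
have := Num.Theory.archi_boundP (divr_ge0 (normr_ge0 b) (ltW a0)).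
rewrite ltr_pdivrMr // => hk.
have := H (Num.Def.archi_bound (`|b| / `|a|)).
rewrite -ler_norml normrM ger0_norm ?ler0n // => h.
have := ler_norm b; lra.
Qed.

Section QuadraticCones.

Variables (R : realType) (A : comAlgType R) (V : lmodType A).
Implicit Types (M N : V -> Prop) (u v w f : V) (a b s : A).

(** Stability under nonnegative real scalars is implied: such a scalar is the square of a scalar of
    [A]. *)
Definition quadratic_cone M :=
  (forall v w, M v -> M w -> M (v + w)) /\ (forall a v, M v -> M (a ^+ 2 *: v)).

Definition archimedean_unit M u :=
  M u /\ forall v, exists c : R, 0 < c /\ M (c%:A *: u + v).

Inductive sos : A -> Prop :=
| sos0 : sos 0
| sosD a s : sos s -> sos (a ^+ 2 + s).

Lemma sos_add s t : sos s -> sos t -> sos (s + t).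
Proof. by move=> hs ht; elim: hs => [|a s' _ ih]; rewrite ?add0r // -addrA; constructor. Qed.

Lemma sos_mul_sqr a s : sos s -> sos (a ^+ 2 * s).
Proof.
elim=> [|b s' _ ih]; first by rewrite mulr0; constructor.
by rewrite mulrDr -exprMn; constructor.
Qed.

Lemma sos1 : sos 1.
Proof. by rewrite -[1]addr0 -(expr1n _ 2); do 2 constructor. Qed.

Section Cone.

Variables (M : V -> Prop) (u : V).
Hypotheses (qM : quadratic_cone M) (uM : archimedean_unit M u).

Let MD v w : M v -> M w -> M (v + w). Proof. exact: qM.1. Qed.

Let MX a v : M v -> M (a ^+ 2 *: v). Proof. exact: qM.2. Qed.

Lemma cone0 : M 0.
Proof. by have := MX 0 uM.1; rewrite expr0n scale0r. Qed.

Lemma coneZ (c : R) v : 0 <= c -> M v -> M (c%:A *: v).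
Proof.
move=> c0 Mv; rewrite -(sqr_sqrtr c0) -[_%:A]/(in_alg A _) rmorphXn /=.
exact: MX.
Qed.

Lemma cone_unit (c : R) : 0 <= c -> M (c%:A *: u).
Proof. by move=> c0; apply: coneZ => //; case: uM. Qed.

Lemma cone_sos s v : sos s -> M v -> M (s *: v).
Proof.
move=> hs Mv; elim: hs => [|a s' _ ih]; first by rewrite scale0r; exact: cone0.
by rewrite scalerDl; apply: MD => //; exact: MX.
Qed.

Lemma cone_bound v : exists c : R, [/\ 0 < c, M (c%:A *: u + v) & M (c%:A *: u - v)].
Proof.
have [c [c0 hc]] := uM.2 v; have [d [d0 hd]] := uM.2 (- v).
exists (c + d); split; first lra.
  rewrite scalerDl scalerDl addrAC; apply: MD => //; apply: cone_unit; lra.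
by rewrite addrC scalerDl scalerDl addrCA; apply: MD; [apply: cone_unit; lra|rewrite addrC].
Qed.

(** Natural bounds are needed because the descent below is an induction on an integer multiple of
    [u]. *)
Lemma cone_large_nat v : exists2 k0 : nat, (0 < k0)%N &
  forall k : nat, (k0 <= k)%N -> M (k%:R *: u + v).
Proof.
have [c [c0 hc]] := uM.2 v.
have h := Num.Theory.archi_boundP (ltW c0).
exists (Num.Def.archi_bound c).+1 => // k hk.
have kc : c <= k%:R by apply: le_trans (ltW h) _; rewrite ler_nat ltnW.
have -> : k%:R = (k%:R - c)%:A + c%:A :> A.
  by rewrite -scalerDl subrK scaler_nat.
by rewrite scalerDl -addrA; apply: MD => //; apply: cone_unit; lra.
Qed.

(* Jacobi's descent: writing [k] for a large integer, it replaces
   [f + (j / k^2) u] by [f + ((j - 1) / k^2) u], through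
   [k^2 (k^2 f + (j - 1) u) = (k - s)^2 (k^2 f + j u) + k^2 ((2k - 1) u - s^2 f)
    + 2 k^3 (s f - u) + j s (2k - s) u]. *)
Lemma cone_of_sos_mul f s : sos s -> M (s *: f - u) -> M f.
Proof.
move=> hs hsf.
pose T a b := M (a *: f + b *: u).
have TD a b c d : T a b -> T c d -> T (a + c) (b + d).
  by rewrite /T !scalerDl addrACA; exact: MD.
have TS t a b : sos t -> T a b -> T (t * a) (t * b).
  by move=> ht; rewrite /T -!scalerA -scalerDr; exact: cone_sos.
have [k1 _ h1] := cone_large_nat (- (s *: u)).
have [k2 _ h2] := cone_large_nat (- (s ^+ 2 *: f) - u).
have [k3 k3_gt0 h3] := cone_large_nat f.
pose k := (k1 + k2 + k3)%N; pose X : A := k%:R.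
have sos_nat l : sos l%:R.
  by elim: l => [|l ih]; [exact: sos0|rewrite mulrSr; apply: sos_add ih sos1].
have {}h1 : T 0 (2 * X - s).
  rewrite /T scale0r add0r scalerBl /X -natrM; apply: h1; rewrite /k; lia.
have {}h2 : T (- s ^+ 2) (2 * X - 1).
  rewrite /T !scalerBl scale1r scaleNr addrCA /X -natrM; apply: h2; rewrite /k; lia.
have {}h3 : T 1 X by rewrite /T scale1r addrC; apply: h3; rewrite /k; lia.
have {}hsf : T s (- 1) by rewrite /T scaleN1r.
have sosX2 : sos (X ^+ 2) by rewrite -[_ ^+ 2]addr0; do 2 constructor.
have divX v : M (X ^+ 2 *: v) -> M v.
  move=> /(MX (k%:R^-1)%:A).
  rewrite scalerA -exprMn -[_%:A]/(in_alg A _) /X -(rmorph_nat (in_alg A)) -rmorphM.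
  by rewrite mulVf ?rmorph1 ?expr1n ?scale1r // pnatr_eq0 /k; lia.
suff {h3} descend j : T (X ^+ 2) j%:R -> T (X ^+ 2) 0.
  (* The descent starts at [j = k ^ 3], from [k ^ 2] times the membership of [f + k u]. *)
  have : T (X ^+ 2) (k ^ 3)%:R.
    have -> : (k ^ 3)%:R = X ^+ 2 * X by rewrite natrX exprSr.
    by rewrite -{1}[X ^+ 2]mulr1; apply: TS.
  by move=> /descend; rewrite /T scale0r addr0 => /divX.
elim: j => // j ih hj; apply: ih.
suff : T (X ^+ 2 * X ^+ 2) (X ^+ 2 * j%:R).
  by rewrite {1}/T -[X in M (X + _)]scalerA -[X in M (_ + X)]scalerA -scalerDr => /divX.
have soss : sos ((X - s) ^+ 2) by rewrite -[_ ^+ 2]addr0; do 2 constructor.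
(* The four terms of the identity are added in order, with [j.+1] in the place of [j]. *)
have := TD _ _ _ _ (TS _ _ _ soss hj) (TS _ _ _ sosX2 h2).
move=> /TD /(_ (TS _ _ _ sosX2 (TS _ _ _ (sos_nat (2 * k)%N) hsf))).
move=> /TD /(_ (TS _ _ _ (sos_nat j.+1) (TS _ _ _ hs h1))).
by congr T; rewrite natrM -/X mulrSr; ring.
Qed.

End Cone.

(** * Maximal proper cones *)

Definition adjoin M w v := exists m s, [/\ M m, sos s & v = m + s *: w].

Lemma adjoin_sub M w v : M v -> adjoin M w v.
Proof. by move=> Mv; exists v, 0; rewrite scale0r addr0; split=> //; constructor. Qed.

Lemma adjoin_mem M w : M 0 -> adjoin M w w.
Proof. by move=> M0; exists 0, 1; rewrite scale1r add0r; split=> //; exact: sos1. Qed.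

Lemma adjoin_quadratic M w : quadratic_cone M -> quadratic_cone (adjoin M w).
Proof.
move=> [MD MX]; split=> [_ _ [m [s [Mm ss ->]]] [m' [s' [Mm' ss' ->]]]|].
  exists (m + m'), (s + s'); split; [exact: MD|exact: sos_add|].
  by rewrite scalerDl addrACA.
move=> a _ [m [s [Mm ss ->]]]; exists (a ^+ 2 *: m), (a ^+ 2 * s).
by split; [exact: MX|exact: sos_mul_sqr|rewrite scalerDr scalerA].
Qed.

Lemma archimedean_unit_sub M N u :
  (forall v, M v -> N v) -> archimedean_unit M u -> archimedean_unit N u.
Proof.
move=> MN [Mu uM]; split; first exact: MN.
by move=> v; have [c [c0 hc]] := uM v; exists c; split=> //; exact: MN.
Qed.

Lemma maximal_proper_cone K u :
  quadratic_cone K -> K 0 -> ~ K (- u) -> exists N : V -> Prop,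
  [/\ quadratic_cone N, (forall v, K v -> N v), ~ N (- u) &
      forall w, ~ adjoin N w (- u) -> N w].
Proof.
move=> qK K0 Ku.
(* Zorn's lemma also tests the empty chain, whose union is empty. Imposing the cone axioms on the
   union of [K] and [X], not on [X], makes the empty set admissible. *)
pose P (X : classical_sets.set V) :=
  quadratic_cone (fun v => K v \/ X v) /\ ~ X (- u).
have [X [[qX Xu] maxX]] : exists X, P X /\ forall Y, classical_sets.proper X Y -> ~ P Y.
  apply: classical_sets.Zorn_bigcup => F FP Ftot; split; last first.
    by case=> X FX Xu; case: (FP _ FX).
  have pick v w : K v \/ classical_sets.bigcup F id v ->
      K w \/ classical_sets.bigcup F id w ->
      (K v /\ K w) \/ exists X, [/\ F X, K v \/ X v & K w \/ X w].
    case=> [Kv|[X FX Xv]] [Kw|[Y FY Yw]]; first by left.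
    - by right; exists Y; split=> //; [left|right].
    - by right; exists X; split=> //; [right|left].
    - right; case: (Ftot _ _ FX FY) => h.
        by exists Y; split=> //; right=> //; exact: h.
      by exists X; split=> //; right=> //; exact: h.
  split=> [v w hv hw|a v hv].
    case: (pick v w hv hw) => [[Kv Kw]|[X [FX Xv Xw]]]; first by left; exact: qK.1.
    have [[XD _] _] := FP _ FX.
    by case: (XD _ _ Xv Xw); [left|right; exists X].
  case: (pick v v hv hv) => [[Kv _]|[X [FX Xv _]]]; first by left; exact: qK.2.
  have [[_ XX] _] := FP _ FX.
  by case: (XX a _ Xv); [left|right; exists X].
exists (fun v => K v \/ X v); split=> //; [by left|by case|].
move=> w hw; apply: boolp.contrapT => nw; apply: (maxX (adjoin (fun v => K v \/ X v) w)).
  split=> [v Xv|h]; first by apply: adjoin_sub; right.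
  by apply: nw; right; apply: h; apply: adjoin_mem; left.
split=> //.
have Kadj v : K v -> adjoin (fun v => K v \/ X v) w v by move=> ?; apply: adjoin_sub; left.
have [adjD adjX] := adjoin_quadratic w qX.
split=> [v v' hv hv'|a v hv]; right.
  by apply: adjD; [case: hv|case: hv'] => // /Kadj.
by apply: adjX; case: hv => // /Kadj.
Qed.

(** If neither [v] nor [- v] is in [N], maximality gives [- u = n1 + s1 v = n2 - s2 v]. Eliminating
    [v] gives [- (s1 + s2) u = s2 n1 + s1 n2], so [- s1 u] is in [N]. As [c u + v] is in [N] for
    some [c > 0], so is [s1 v = s1 (c u + v) - c s1 u], and then [- u = n1 + s1 v] is in [N], which
    is excluded. *)
Lemma maximal_cone_total N u :
  quadratic_cone N -> archimedean_unit N u -> ~ N (- u) ->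
  (forall w, ~ adjoin N w (- u) -> N w) -> forall v, N v \/ N (- v).
Proof.
move=> qN uN Nu maxN v; have [ND _] := qN; have [Nu1 _] := uN.
apply: boolp.contrapT => hv.
have [n1 [s1 [Nn1 hs1 e1]]] : adjoin N v (- u).
  by apply: boolp.contrapT => /maxN; tauto.
have [n2 [s2 [Nn2 hs2 e2]]] : adjoin N (- v) (- u).
  by apply: boolp.contrapT => /maxN; tauto.
have Ns1 : N (- (s1 *: u)).
  have -> : - (s1 *: u) = s2 *: n1 + s1 *: n2 + s2 *: u.
    have -> : n1 = - u - s1 *: v by rewrite e1 addrK.
    have -> : n2 = - u + s2 *: v by rewrite e2 scalerN subrK.
    rewrite scalerBr scalerDr !scalerN !scalerA (mulrC s1 s2).
    by rewrite addrACA addNr addr0 addrAC addNr add0r.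
  by do 2 (apply: (ND); last exact: (cone_sos qN uN)); apply: (cone_sos qN uN).
have [c [c0 hc _]] := cone_bound qN uN v.
apply: Nu; rewrite e1; apply: (ND) => //.
have -> : s1 *: v = s1 *: (c%:A *: u + v) + c%:A *: - (s1 *: u).
  by rewrite scalerDr scalerN !scalerA (mulrC s1) addrAC subrr add0r.
apply: (ND); first exact: (cone_sos qN uN).
by apply: (coneZ qN) => //; exact: ltW.
Qed.

(** * The state defined by a total cone, and its multiplicativity *)

Section State.

Variables (N : V -> Prop) (u : V).
Hypotheses (qN : quadratic_cone N) (uN : archimedean_unit N u) (nNu : ~ N (- u)).
Hypothesis totN : forall v, N v \/ N (- v).

Let ND v w : N v -> N w -> N (v + w). Proof. exact: qN.1. Qed.

Let cone_unit_ge0 (c : R) : N (c%:A *: u) -> 0 <= c.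
Proof.
rewrite leNgt => Nc; apply/negP => c0; apply: nNu.
have -> : - u = (- c^-1)%:A *: (c%:A *: u).
  rewrite scalerA -[_%:A]/(in_alg A _) -[c%:A]/(in_alg A _) -rmorphM mulNr mulVf ?lt_eqF //.
  by rewrite rmorphN rmorph1 scaleN1r.
by apply: (coneZ qN) => //; rewrite oppr_ge0 invr_le0 ltW.
Qed.

(** The real number that [v] represents in the order of [N], measured in units of [u]. The slack [d]
    is there because [N] need not be closed. *)
Definition cone_value v (t : R) :=
  forall d, 0 < d -> N ((t + d)%:A *: u - v) /\ N (v - (t - d)%:A *: u).

Lemma cone_value_ex v : exists t, cone_value v t.
Proof.
(* The value is the supremum of the lower bounds of [v]; totality turns a failure to be a lower
   bound into an upper bound. *)
pose S := fun t : R => N (v - t%:A *: u).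
have [c [c0 h1 h2]] := cone_bound qN uN v.
have supS : classical_sets.has_sup S.
  split; first by exists (- c); rewrite /S scaleNr scaleNr opprK addrC.
  exists c => t St; rewrite -subr_ge0; apply: cone_unit_ge0.
  have := ND h2 St; rewrite addrA subrK.
  by rewrite -scalerBl -scalerBl.
exists (sup S) => d d0; split.
  case: (totN ((sup S + d)%:A *: u - v)) => //; rewrite opprB => h.
  have := sup_upper_bound supS h; lra.
have [t St lt_t] := sup_adherent d0 supS.
have -> : v - (sup S - d)%:A *: u = (v - t%:A *: u) + (t - (sup S - d))%:A *: u.
  by rewrite [(t - _)%:A]scalerBl [(_ - _) *: u]scalerBl addrA subrK.
by apply: ND => //; apply: (cone_unit qN uN); lra.
Qed.

Lemma cone_value_le v w t t' : cone_value v t -> cone_value w t' -> N (w - v) -> t <= t'.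
Proof.
move=> hv hw Nwv; rewrite -subr_ge0; apply: (@ge0_of_le_small _ _ 2) => // d d0.
apply: cone_unit_ge0; have := ND (ND (hv d d0).2 Nwv) (hw d d0).1.
rewrite [X in N X](_ : _ = (t' + d)%:A *: u - (t - d)%:A *: u).
  by rewrite -scalerBl -scalerBl; congr (N (_%:A *: _)); ring.
by rewrite (addrC v) (addrC w) addrA addrA addrK addrAC addrK addrC.
Qed.

Lemma cone_valueD v w t t' :
  cone_value v t -> cone_value w t' -> cone_value (v + w) (t + t').
Proof.
move=> hv hw d d0; have d2 : 0 < d / 2 by lra.
have [a1 a2] := hv _ d2; have [b1 b2] := hw _ d2; split.
  have := ND a1 b1; congr N; rewrite addrACA -opprD -scalerDl -scalerDl.
  by congr (_%:A *: _ - _); field.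
have := ND a2 b2; congr N; rewrite addrACA -opprD -scalerDl -scalerDl.
by congr (_ - _%:A *: _); field.
Qed.

Lemma cone_value_unitZ c : cone_value (c%:A *: u) c.
Proof.
move=> d d0; rewrite -!scalerBl; split; apply: (cone_unit qN uN); lra.
Qed.

Lemma cone_valueZ c v t : 0 < c -> cone_value v t -> cone_value (c%:A *: v) (c * t).
Proof.
move=> c0 hv d d0; have [h1 h2] := hv (d / c) (divr_gt0 d0 c0).
have e (b : R) : c%:A *: (b%:A *: u) = (c * b)%:A *: u :> V.
  by rewrite scalerA -[c%:A]/(in_alg A _) -[b%:A]/(in_alg A _) -rmorphM.
split.
  have := coneZ qN (ltW c0) h1; rewrite scalerBr e.
  by congr (N (_%:A *: _ - _)); field; rewrite gt_eqF.
have := coneZ qN (ltW c0) h2; rewrite scalerBr e.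
by congr (N (_ - _%:A *: _)); field; rewrite gt_eqF.
Qed.

(** The last clause is a converse to positivity up to an arbitrarily small multiple of [u]: the
    kernel of [L] consists of infinitesimals for [N]. *)
Lemma total_cone_state : exists L : V -> R,
  [/\ forall v w, L (v + w) = L v + L w, forall c v, L (c%:A *: v) = c * L v,
      L u = 1, forall v, N v -> 0 <= L v &
      forall d v, 0 < d -> L v = 0 -> N (d%:A *: u + v)].
Proof.
have [L hL] := boolp.choice cone_value_ex.
have uniq v t : cone_value v t -> L v = t.
  have N0 : N (v - v) by rewrite subrr; exact: (cone0 qN uN).
  by move=> h; apply/eqP; rewrite eq_le !(@cone_value_le v v).
have LD v w : L (v + w) = L v + L w by apply: uniq; exact: cone_valueD.
have L0 : L 0 = 0 by apply: (addrI (L 0)); rewrite -LD !addr0.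
have LN v : L (- v) = - L v by apply/eqP; rewrite -addr_eq0 -LD addNr L0.
exists L; split=> //.
- move=> c v; have [c0|c0|<-] := ltrgtP 0 c; first by apply: uniq; exact: cone_valueZ.
    rewrite -[c]opprK scaleNr scaleNr LN mulNr; congr (- _).
    by apply: uniq; apply: cone_valueZ => //; rewrite oppr_gt0.
  by rewrite !scale0r mul0r.
- by apply: uniq; rewrite -{1}[u]scale1r -(scale1r (1 : A)); exact: cone_value_unitZ.
- move=> v Nv; apply: (cone_value_le (v := 0) (w := v)) => //; last by rewrite subr0.
  by rewrite -L0; exact: hL.
move=> d v d0 Lv; have := (hL v d d0).2.
by rewrite Lv sub0r scaleNr scaleNr opprK addrC.
Qed.

(* If [L (a *: u) = 0] then [- d <= a <= d] in the order of [N] for all [d > 0]; multiplying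
   by squares and polarizing, [L] kills [g * a *: u] for every [g], in particular
   [a ^+ 2 *: u], hence [a ^+ 2 *: v] since [v] is bounded by a multiple of [u].
   Positivity on the squares [(1 + k * a) ^+ 2], [k] in [int], then gives [L (a *: v) = 0]. *)
Lemma total_cone_character : exists L : V -> R,
  [/\ forall v w, L (v + w) = L v + L w, forall c v, L (c%:A *: v) = c * L v,
      L u = 1, forall v, N v -> 0 <= L v &
      forall a v, L (a *: v) = L (a *: u) * L v].
Proof.
have [L [LD LZ L1 Lge0 Lsmall]] := total_cone_state.
exists L; split=> // a0 v0.
have L0 : L 0 = 0 by apply: (addrI (L 0)); rewrite -LD !addr0.
have LN v : L (- v) = - L v by apply/eqP; rewrite -addr_eq0 -LD addNr L0.
have Lnat (k : nat) v : L (k%:R *: v) = k%:R * L v.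
  by rewrite -LZ [k%:R%:A]scaler_nat.
(* Subtracting the scalar [L (a0 *: u)] from [a0] reduces multiplicativity to this case. *)
suff key a : L (a *: u) = 0 -> forall v, L (a *: v) = 0.
  have := key (a0 - (L (a0 *: u))%:A).
  rewrite scalerBl LD LN LZ L1 mulr1 subrr => /(_ erefl v0).
  by rewrite scalerBl LD LN LZ => /eqP; rewrite subr_eq0 => /eqP.
move=> La.
have Lsqr h : L (h ^+ 2 *: (a *: u)) = 0.
  have Lh : 0 <= L (h ^+ 2 *: u) by apply: Lge0; apply: qN.2; case: uN.
  have half b : L (b *: u) = 0 -> 0 <= L (h ^+ 2 *: (b *: u)).
    move=> Lb; apply: ge0_of_le_small Lh _ => d d0.
    have := Lge0 _ (qN.2 h _ (Lsmall d _ d0 Lb)).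
    by rewrite scalerDr LD [h ^+ 2 *: (d%:A *: u)]scalerA [_ * d%:A]mulrC -scalerA LZ addrC.
  apply/eqP; rewrite eq_le half // andbT.
  have := half (- a); rewrite scaleNr LN La oppr0 => /(_ erefl).
  by rewrite scalerN LN oppr_ge0.
have Lmul g : L ((g * a) *: u) = 0.
  have := Lnat 4%N ((g * a) *: u).
  have -> : 4%:R *: ((g * a) *: u) = (g + 1) ^+ 2 *: (a *: u) - (g - 1) ^+ 2 *: (a *: u).
    by rewrite !scalerA -scalerBl; congr (_ *: _); ring.
  by rewrite LD LN !Lsqr subrr => /esym/eqP; rewrite mulf_eq0 pnatr_eq0 /= => /eqP.
have La2 v : N v -> L (a ^+ 2 *: v) = 0.
  move=> Nv; have [c [c0 _ h2]] := cone_bound qN uN v.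
  apply/eqP; rewrite eq_le Lge0 ?andbT; last exact: qN.2.
  have := Lge0 _ (qN.2 a _ h2).
  by rewrite scalerBr scalerA LD LN expr2 mulrAC Lmul sub0r oppr_ge0.
have LaN v : N v -> L (a *: v) = 0.
  move=> Nv; apply: (@eq0_of_natmul_le _ _ (L v)) => k.
  have h (b : A) : b ^+ 2 = a ^+ 2 -> 0 <= L v + 2 * (k%:R * L (b *: v)).
    move=> hb; have := Lge0 _ (qN.2 (1 + k%:R * b) _ Nv).
    have -> : (1 + k%:R * b) ^+ 2 = 1 + 2%:R * (k%:R * b) + (k ^ 2)%:R * b ^+ 2.
      by rewrite natrX; ring.
    rewrite hb !scalerDl !LD scale1r -(scalerA 2%:R) -(scalerA k%:R).
    by rewrite -(scalerA (k ^ 2)%:R) !Lnat La2 // mulr0 addr0.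
  have := h a erefl; have := h (- a) (sqrrN a); have := Lge0 _ Nv.
  rewrite scaleNr LN; lra.
move=> v; have [c [c0 h1 _]] := cone_bound qN uN v.
have := LaN _ h1.
by rewrite scalerDr scalerA LD mulrC Lmul add0r.
Qed.

End State.

Lemma quadratic_cone_separation M u f :
  quadratic_cone M -> archimedean_unit M u -> ~ M f -> exists L : V -> R,
  [/\ (forall v w, L (v + w) = L v + L w) /\ (forall c v, L (c%:A *: v) = c * L v),
      L u = 1, forall v, M v -> 0 <= L v,
      L f <= 0 & forall a v, L (a *: v) = L (a *: u) * L v].
Proof.
move=> qM uM Mf.
have qK := adjoin_quadratic (- f) qM.
have M0 := cone0 qM uM.
have MK v : M v -> adjoin M (- f) v by exact: adjoin_sub.
have [||N [qN KN Nu maxN]] := maximal_proper_cone (u := u) qK.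
- exact: MK.
(* If [- u = m - s f] with [m] in [M], then [s f - u = m] is in [M], and the descent puts [f] itself
   in [M]. *)
- move=> [m [s [Mm hs e]]]; apply: Mf; apply: (cone_of_sos_mul qM uM hs).
  by move: Mm; congr M; move/eqP: e; rewrite scalerN eq_sym subr_eq addrC => /eqP.
have uN : archimedean_unit N u.
  by apply: archimedean_unit_sub uM => v Mv; apply: KN; exact: MK.
have totN := maximal_cone_total qN uN Nu maxN.
have [L [LD LZ L1 Lge0 Lmul]] := total_cone_character qN uN Nu totN.
have L0 : L 0 = 0 by apply: (addrI (L 0)); rewrite -LD !addr0.
exists L; split=> // [v Mv|]; first by apply: Lge0; apply: KN; exact: MK.
have : 0 <= L (- f) by apply: Lge0; apply: KN; exact: adjoin_mem.
suff -> : L (- f) = - L f by rewrite oppr_ge0.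
by apply/eqP; rewrite -addr_eq0 -LD addNr L0.
Qed.

End QuadraticCones.

(** * Positive semidefinite real matrices *)

Section RealMatrices.

Variable R : realType.

Lemma psd_congr (d e : nat) (M : 'M[R]_d) (T : 'M_(d, e)) : psd M -> psd (T^T *m M *m T).
Proof.
move=> [sM pM]; split; first by rewrite !trmx_mul trmxK sM mulmxA.
by move=> v; have := pM (T *m v); rewrite trmx_mul !mulmxA.
Qed.

(** The form at [t w + v] is affine in [t] when it vanishes at [w]. Being nonnegative for every [t],
    it has slope zero; taking for [v] the basis vectors gives each entry of [M w]. *)
Lemma psd_kernel (d : nat) (M : 'M[R]_d) (w : 'cV_d) :
  psd M -> (w^T *m M *m w) ord0 ord0 = 0 -> M *m w = 0.
Proof.
move=> [sM pM] w0; apply/matrixP => i j; rewrite [j]ord1 [RHS]mxE.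
pose v : 'cV[R]_d := delta_mx i 0.
have -> : (M *m w) i ord0 = (v^T *m M *m w) ord0 ord0.
  by rewrite -mulmxA trmx_delta -rowE [RHS]mxE.
have sym : (w^T *m M *m v) ord0 ord0 = (v^T *m M *m w) ord0 ord0.
  by rewrite -[LHS]trace_mx11 -mxtrace_tr !trmx_mul trmxK sM mulmxA trace_mx11.
suff : 2 * (v^T *m M *m w) ord0 ord0 = 0 by lra.
apply: (@eq0_of_natmul_le _ _ ((v^T *m M *m v) ord0 ord0)) => k.
have entD (X Y : 'M[R]_1) : (X + Y) ord0 ord0 = X ord0 ord0 + Y ord0 ord0 by rewrite mxE.
have entZ a (X : 'M[R]_1) : (a *: X) ord0 ord0 = a * X ord0 ord0 by rewrite mxE.
have h (t : R) : 0 <= t * (2 * (v^T *m M *m w) ord0 ord0) + (v^T *m M *m v) ord0 ord0.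
  have := pM (t *: w + v).
  rewrite [(_ + _)^T]linearD /= [(_ *: w)^T]linearZ /= !mulmxDl !mulmxDr.
  rewrite -!scalemxAl -!scalemxAr !entD !entZ.
  rewrite w0 sym; lra.
have := h k%:R; have := h (- k%:R); lra.
Qed.

(** Induction on the size through the Schur complement of the top left entry, as in Cholesky's
    algorithm. The left inverse [D] expresses that [C] has full column rank. *)
Lemma psd_full_rank_factor (d : nat) (B : 'M[R]_d) : psd B ->
  exists s (C : 'M_(d, s)) (D : 'M_(s, d)), B = C *m C^T /\ D *m C = 1%:M.
Proof.
elim: d B => [|d ih] B pB.
  by exists 0%N, 0, 0; split; rewrite [LHS]flatmx0 [RHS]flatmx0.
pose a := B 0 0.
have [b [B' eB]] : exists b (B' : 'M_d), B = block_mx a%:M b^T b B' :> 'M_(1 + d).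
  exists (@dlsubmx _ 1 d 1 d B), (@drsubmx _ 1 d 1 d B).
  rewrite -[LHS](@submxK _ 1 d 1 d); congr block_mx.
    by rewrite [LHS]mx11_scalar !mxE /a; congr (B _ _)%:M; apply: val_inj.
  by rewrite trmx_dlsub pB.1.
have a0 : 0 <= a.
  by have := pB.2 (delta_mx 0 0); rewrite trmx_delta -rowE -colE !mxE.
(* When [a = 0], [a^-1 = 0] and psd-ness forces [b = 0]: the formula covers both cases. *)
have pS : psd (B' - a^-1 *: (b *m b^T)).
  have := psd_congr (col_mx (- a^-1 *: b^T) 1%:M : 'M_(1 + d, d)) pB.
  have -> : (col_mx (- a^-1 *: b^T) 1%:M)^T = row_mx (- a^-1 *: b) 1%:M :> 'M_(d, 1 + d).
    by rewrite tr_col_mx [(_ *: _)^T]linearZ /= trmxK trmx1.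
  congr psd; rewrite eB mul_row_block mul_row_col !mul1mx !mulmx1.
  rewrite mul_mx_scalar mulmxDl -!scalemxAl -!scalemxAr !scalerA.
  have -> : a * - a^-1 * - a^-1 = a^-1.
    by have [->|an0] := eqVneq a 0; [rewrite invr0; ring|field].
  by rewrite scaleNr subrr add0r addrC.
have [s [C [D [eC eD]]]] := ih _ pS.
have {eC} eB' : B' = C *m C^T + a^-1 *: (b *m b^T) by rewrite -eC subrK.
(* The goal is restated with the size shown as [1 + d], the form that block matrices require. *)
suff : exists s (C : 'M_(1 + d, s)) (D : 'M_(s, 1 + d)),
    B = C *m C^T :> 'M_(1 + d) /\ D *m C = 1%:M by [].
have [a_eq0|a_neq0] := eqVneq a 0.
  have b0 : b = 0.
    have := @psd_kernel _ _ (col_mx 1%:M 0 : 'cV_(1 + d)) pB.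
    rewrite eB tr_col_mx trmx1 trmx0 mul_row_block !mul1mx !mul0mx !addr0.
    rewrite mul_row_col mulmx0 addr0 mulmx1 mxE a_eq0 mulr1n => /(_ erefl).
    rewrite mul_block_col !mulmx0 !addr0 !mulmx1.
    by move=> /(congr1 (@dsubmx _ 1 d 1)); rewrite col_mxKd linear0.
  exists s, (col_mx 0 C : 'M_(1 + d, s)), (row_mx 0 D : 'M_(s, 1 + d)).
  split; last by rewrite mul_row_col mul0mx add0r.
  by rewrite eB tr_col_mx mul_col_row eB' b0 a_eq0 !(mulmx0, mul0mx, trmx0, scaler0, addr0) raddf0.
pose t := Num.sqrt a.
have t2 : t ^+ 2 = a by rewrite sqr_sqrtr.
have t0 : t != 0 by apply: contra a_neq0; rewrite -t2 => /eqP ->; rewrite expr0n.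
(* The new column is the first column of [B] divided by [t]; the left inverse is found by block
   triangular inversion. *)
exists (1 + s)%N, (block_mx t%:M 0 (t^-1 *: b) C : 'M_(1 + d, 1 + s)).
exists (block_mx t^-1%:M 0 (- a^-1 *: (D *m b)) D : 'M_(1 + s, 1 + d)).
split.
  rewrite eB tr_block_mx mulmx_block !trmx0 !(mulmx0, mul0mx, addr0) tr_scalar_mx linearZ /=.
  rewrite -!scalemxAr -!scalemxAl !mul_mx_scalar !mul_scalar_mx !scalerA scale_scalar_mx.
  rewrite !mulVf // !scale1r -expr2 t2 eB' -t2 addrC.
  by congr (block_mx _ _ _ (_ *: _ + _)); rewrite expr2 invfM.
rewrite mulmx_block !(mulmx0, mul0mx, addr0, add0r) eD -!scalemxAr -!scalemxAl.
rewrite !mul_mx_scalar !scalerA scale_scalar_mx divff // -scalerDl.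
rewrite (_ : _ + _ = 0) ?scale0r -?scalar_mx_block // -t2; by field.
Qed.

(** The two-sided bounds force the kernel of [B0] into that of each [B k]. Since [D C = 1], every
    [w - (C D)^T w] lies in the kernel of [B0], so [B k = B k (C D)^T]. By symmetry also
    [B k = C D (B k)], which leads to [A k = D (B k) D^T]. *)
Lemma psd_dominated_factor (I : Type) (d : nat) (B0 : 'M[R]_d) (B : I -> 'M[R]_d) :
  psd B0 -> (forall k, (B k)^T = B k) ->
  (forall k, exists c, psd (c *: B0 + B k)) -> (forall k, exists c, psd (c *: B0 - B k)) ->
  exists s (C : 'M_(d, s)) (D : 'M_(s, d)) (A : I -> 'M_s),
  [/\ B0 = C *m C^T, D *m C = 1%:M, forall k, (A k)^T = A k &
      forall k, B k = C *m A k *m C^T].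
Proof.
move=> pB0 sB hp hn; have [s [C [D [eB0 eD]]]] := psd_full_rank_factor pB0.
exists s, C, D, (fun k => D *m B k *m D^T); split=> // [k|k].
  by rewrite !trmx_mul trmxK sB mulmxA.
have BN (w : 'cV_d) : B k *m (w - (C *m D)^T *m w) = 0.
  set w' := w - _.
  have w'0 : B0 *m w' = 0.
    rewrite /w' mulmxBr eB0 trmx_mul !mulmxA -(mulmxA C C^T D^T) -trmx_mul eD trmx1.
    by rewrite mulmx1 subrr.
  clearbody w'; have [[c pc] [c' pc']] := (hp k, hn k).
  have q0 : (w'^T *m B k *m w') ord0 ord0 = 0.
    apply/eqP; rewrite eq_le; apply/andP; split.
      rewrite -oppr_ge0; have := pc'.2 w'.
      by rewrite mulmxBr mulmxBl -!mulmxA -scalemxAl w'0 scaler0 mulmx0 sub0r mxE.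
    have := pc.2 w'; rewrite mulmxDr mulmxDl -!mulmxA -scalemxAl w'0 scaler0 mulmx0.
    by rewrite add0r.
  have := @psd_kernel _ _ w' pc.
  rewrite mulmxDr !mulmxDl -!mulmxA -scalemxAl w'0 scaler0 mulmx0 !add0r mulmxA.
  exact.
have {BN} BCD : B k = B k *m (C *m D)^T.
  apply/matrixP => i j; apply/eqP; rewrite -subr_eq0; apply/eqP.
  have := BN (delta_mx j 0); rewrite mulmxBr mulmxA -mulmxBl -colE.
  by move=> /matrixP /(_ i 0); rewrite !mxE.
have BCD' : B k = C *m D *m B k by rewrite -[LHS]sB {1}BCD trmx_mul trmxK sB.
by rewrite {1}BCD' {1}BCD trmx_mul !mulmxA.
Qed.

(** * Vectorization and Kronecker products *)

Definition unvec (d s : nat) (v : 'cV[R]_(d * s)) : 'M_(d, s) :=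
  \matrix_(i, j) v (mxtens_index (i, j)) 0.

Definition vec (d s : nat) (K : 'M[R]_(d, s)) : 'cV_(d * s) :=
  \col_k K (mxtens_unindex k).1 (mxtens_unindex k).2.

Lemma vecK d s : cancel (@vec d s) (@unvec d s).
Proof. by move=> K; apply/matrixP => i j; rewrite !mxE mxtens_indexK. Qed.

Lemma sum_mxtens_index (d s : nat) (f : 'I_(d * s) -> R) :
  \sum_k f k = \sum_i \sum_j f (mxtens_index (i, j)).
Proof.
rewrite pair_bigA /= (reindex (@mxtens_index d s)) /=; last first.
  exists (@mxtens_unindex d s) => k _; [exact: mxtens_indexK|exact: mxtens_unindexK].
by apply: eq_bigr => -[].
Qed.

Lemma vec_norm (d s : nat) (K : 'M[R]_(d, s)) : ((vec K)^T *m vec K) 0 0 = \tr (K *m K^T).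
Proof.
rewrite mxE; apply: (etrans (sum_mxtens_index _)); apply: eq_bigr => i _.
by rewrite mxE; apply: eq_bigr => j _; rewrite !mxE mxtens_indexK.
Qed.

(** Under [unvec], the operator [X *t Y] becomes [K |-> X K Y^T], and the Euclidean product becomes
    the trace product. *)
Lemma tens_quadratic_form (d s : nat) (X : 'M[R]_d) (Y : 'M_s) v :
  (v^T *m (X *t Y) *m v) ord0 ord0 = \tr (X *m (unvec v *m Y^T *m (unvec v)^T)).
Proof.
rewrite -mulmxA mxE; apply: (etrans (sum_mxtens_index _)); apply: eq_bigr => i _.
rewrite [RHS]mxE; under [RHS]eq_bigr => k _ do rewrite mxE mulr_sumr.
rewrite exchange_big; apply: eq_bigr => j _ /=.
rewrite [(_ *m v) _ _]mxE mulr_sumr; apply: (etrans (sum_mxtens_index _)); apply: eq_bigr => k _.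
rewrite !mxE mulr_suml !mulr_sumr; apply: eq_bigr => l _.
rewrite tensmxE !mxE; ring.
Qed.

End RealMatrices.

(** * Pencils and the quadratic module *)

Lemma mpoly_character (R : realType) (n : nat) (chi : {mpoly R[n]} -> R) :
  {morph chi : a b / a + b} -> {morph chi : a b / a * b} ->
  (forall c, chi c%:A = c) -> forall a, chi a = a.@[fun i => chi 'X_i].
Proof.
move=> chiD chiM chiC.
have chi1 : chi 1 = 1 by rewrite -(chiC 1) scale1r.
elim/mpolyind => [|c m a _ _ ih].
  by rewrite meval0 -(chiC 0) scale0r.
rewrite chiD ih mevalD mevalZ; congr (_ + _).
rewrite -mulr_algl chiM chiC mevalX mpolyXE_id (big_morph chi chiM chi1).
congr (_ * _); apply: eq_bigr => i _.
by elim: (m i) => [|k ihk]; rewrite ?expr0 // !exprS chiM ihk.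
Qed.

Section Pencils.

Variables (R : realType) (n r : nat).
Notation P := (polyx R n).
Notation lift M := (lift_mx r M).

Lemma lift_mxD a b (M N : 'M[P]_(a, b)) : lift (M + N) = lift M + lift N.
Proof. exact: map_mxD. Qed.

Lemma lift_mxM a b c (M : 'M[P]_(a, b)) (N : 'M_(b, c)) : lift (M *m N) = lift M *m lift N.
Proof. exact: map_mxM. Qed.

Lemma lift_mxZ a b (c : P) (M : 'M[P]_(a, b)) : lift (c *: M) = mpolyC r c *: lift M.
Proof. exact: map_mxZ. Qed.

Lemma lift_mxT a b (M : 'M[P]_(a, b)) : lift M^T = (lift M)^T.
Proof. by rewrite /lift_mx map_trmx. Qed.

Lemma pencil_congr (a b : nat) (T : 'M[P]_(a, b)) (F0 : 'M[P]_a) (F : 'I_r -> 'M[P]_a) :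
  pencil (T^T *m F0 *m T) (fun k => T^T *m F k *m T) =
  (lift T)^T *m pencil F0 F *m lift T.
Proof.
rewrite /pencil mulmxDr mulmxDl mulmx_sumr mulmx_suml; congr (_ + _).
  by rewrite !lift_mxM lift_mxT.
by apply: eq_bigr => k _; rewrite -scalemxAr -scalemxAl !lift_mxM lift_mxT.
Qed.

Lemma pencilT (d : nat) (F0 : 'M[P]_d) (F : 'I_r -> 'M[P]_d) :
  (pencil F0 F)^T = pencil F0^T (fun k => (F k)^T).
Proof.
rewrite /pencil linearD linear_sum /= lift_mxT; congr (_ + _).
by apply: eq_bigr => k _; rewrite linearZ /= lift_mxT.
Qed.

Lemma pencil_entry d (F0 : 'M[P]_d) (F : 'I_r -> 'M[P]_d) i j :
  pencil F0 F i j = mpolyC r (F0 i j) + \sum_(k < r) lambda R n k * mpolyC r (F k i j).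
Proof.
rewrite mxE mxE summxE; congr (_ + _); apply: eq_bigr => k _.
by rewrite !mxE.
Qed.

(** The coefficients are read off at the monomials 1 and [lambda k]. This passes the symmetry of a
    pencil on to its coefficients. *)
Lemma pencil_inj d (F0 F0' : 'M[P]_d) (F F' : 'I_r -> 'M[P]_d) :
  pencil F0 F = pencil F0' F' -> F0 = F0' /\ F =1 F'.
Proof.
move=> e.
have coef (H0 : 'M[P]_d) (H : 'I_r -> 'M[P]_d) i j :
    (pencil H0 H i j)@_0%MM = H0 i j /\ forall k, (pencil H0 H i j)@_U_(k)%MM = H k i j.
  have coefU (mu : 'X_{1.. r}) : (\sum_(k < r) lambda R n k * mpolyC r (H k i j))@_mu =
      \sum_(k < r) H k i j * (U_(k)%MM == mu)%:R.
    rewrite raddf_sum; apply: eq_bigr => k _ /=.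
    by rewrite mulrC mcoeffCM mcoeffX.
  have coefC0 : (mpolyC r (H0 i j))@_0%MM = H0 i j by rewrite mcoeffC [_ == _]eqxx mulr1.
  have coefC1 k : (mpolyC r (H0 i j))@_U_(k)%MM = 0 by rewrite mcoeffC mnm1_eq0 mulr0.
  rewrite pencil_entry; split=> [|k]; rewrite mcoeffD coefU.
    rewrite coefC0 big1; first by rewrite addr0.
    by move=> l _; rewrite mnm1_eq0 mulr0.
  rewrite coefC1 add0r (bigD1 k); last by [].
  rewrite /= eq_mnm1 eqxx mulr1 big1; first by rewrite addr0.
  by move=> l lk; rewrite eq_mnm1 (negPf lk) mulr0.
split=> [|k]; apply/matrixP => i j.
  by rewrite -(coef F0 F i j).1 e (coef _ _ _ _).1.
by rewrite -(coef F0 F i j).2 e (coef _ _ _ _).2.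
Qed.

Lemma eq_pencil d (F0 : 'M[P]_d) (F F' : 'I_r -> 'M[P]_d) :
  F =1 F' -> pencil F0 F = pencil F0 F'.
Proof. by move=> e; apply: (congr1 (fun X => _ + X)); apply: eq_bigr => k _; rewrite e. Qed.

Lemma pencilD d (F0 F0' : 'M[P]_d) (F F' : 'I_r -> 'M[P]_d) :
  pencil (F0 + F0') (fun k => F k + F' k) = pencil F0 F + pencil F0' F'.
Proof.
rewrite /pencil lift_mxD addrACA -big_split /=; apply: (f_equal2 +%R); first by [].
by apply: eq_bigr => k _; rewrite lift_mxD scalerDr.
Qed.

Lemma pencilZ d (a : P) (F0 : 'M[P]_d) (F : 'I_r -> 'M[P]_d) :
  pencil (a *: F0) (fun k => a *: F k) = mpolyC r a *: pencil F0 F.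
Proof.
rewrite /pencil scalerDr scaler_sumr lift_mxZ; apply: (f_equal2 +%R); first by [].
by apply: eq_bigr => k _; rewrite lift_mxZ !scalerA mulrC.
Qed.

Lemma pencilB d (F0 F0' : 'M[P]_d) (F F' : 'I_r -> 'M[P]_d) :
  pencil (F0 - F0') (fun k => F k - F' k) = pencil F0 F - pencil F0' F'.
Proof.
have e : pencil (F0 - F0') (fun k => F k - F' k) + pencil F0' F' = pencil F0 F.
  by rewrite -pencilD subrK; apply: eq_pencil => k; rewrite subrK.
exact: (canRL (addrK _) e).
Qed.

Lemma pencil_scalar d (a : P) :
  pencil (a%:M : 'M[P]_d) (fun=> 0) = (mpolyC r a)%:M.
Proof.
rewrite /pencil big1 ?addr0 => [|k _]; last by rewrite /lift_mx map_mx0 scaler0.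
by rewrite /lift_mx map_scalar_mx.
Qed.

Lemma pencil_in_SV d (F0 : 'M[P]_d) (F : 'I_r -> 'M[P]_d) :
  F0^T = F0 -> (forall k, (F k)^T = F k) -> in_SV (pencil F0 F).
Proof.
move=> s0 s; split; first by rewrite pencilT s0; apply: eq_pencil.
by move=> i j; exists (F0 i j), (fun k => F k i j); exact: pencil_entry.
Qed.

End Pencils.

Section QuadraticModule.

Variables (R : realType) (n r m : nat) (q : 'I_m -> nat).
Variable G : forall i : 'I_m, 'M[polyxl R n r]_(q i).
Variable p : nat.
Notation P := (polyx R n).
Notation lift M := (lift_mx r M).
Implicit Types Q : 'M[polyxl R n r]_p.

Lemma qmoduleD Q Q' : qmodule G Q -> qmodule G Q' -> qmodule G (Q + Q').
Proof.
move=> [S [N [H [[t [T ->]] ->]]]] [S' [N' [H' [[t' [T' ->]] ->]]]].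
exists (T^T *m T + T'^T *m T'), (fun i => (N i + N' i)%N).
exists (fun i nu => match split nu with inl a => H i a | inr b => H' i b end).
split; first by exists (t + t')%N, (col_mx T T'); rewrite tr_col_mx mul_row_col.
rewrite lift_mxD addrACA -big_split /=; apply: (congr1 (fun X => _ + X)).
apply: eq_bigr => i _; rewrite big_split_ord /=.
apply: (f_equal2 +%R); apply: eq_bigr => nu _; first by rewrite (unsplitK (inl nu)).
by rewrite (unsplitK (inr nu)).
Qed.

Lemma qmodule_congr Q (T : 'M[P]_p) :
  qmodule G Q -> qmodule G ((lift T)^T *m Q *m lift T).
Proof.
move=> [S [N [H [[t [B ->]] ->]]]].
exists ((B *m T)^T *m (B *m T)), N, (fun i nu => H i nu *m T).
split; first by exists t, (B *m T).
rewrite mulmxDr mulmxDl !lift_mxM !lift_mxT !lift_mxM trmx_mul !mulmxA; congr (_ + _).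
rewrite mulmx_sumr mulmx_suml; apply: eq_bigr => i _.
rewrite mulmx_sumr mulmx_suml; apply: eq_bigr => nu _.
by rewrite lift_mxM trmx_mul !mulmxA.
Qed.

Lemma qmodule_sqr Q (a : P) : qmodule G Q -> qmodule G (mpolyC r (a ^+ 2) *: Q).
Proof.
move=> /(qmodule_congr a%:M); congr qmodule.
rewrite /lift_mx map_scalar_mx tr_scalar_mx mul_scalar_mx mul_mx_scalar scalerA.
by rewrite -expr2 rmorphXn.
Qed.

Lemma qmodule_sos t (T : 'M[P]_(t, p)) : qmodule G (lift (T^T *m T)).
Proof.
exists (T^T *m T), (fun=> 0%N), (fun _ _ => 0); split; first by exists t, T.
by rewrite big1 ?addr0 // => i _; rewrite big_ord0.
Qed.

Lemma qmodule_gen (i : 'I_m) (H : 'M[P]_(q i, p)) :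
  qmodule G ((lift H)^T *m G i *m lift H).
Proof.
exists 0, (fun j => (j == i) : nat).
(* The number of rows must vary with [j]: [conform_mx] returns [H] at [j = i], and for other [j] the
   index set is empty. *)
exists (fun j _ => conform_mx 0 H).
split; first by exists 0%N, 0; rewrite trmx0 mul0mx.
rewrite [lift_mx _ 0]map_mx0 add0r (bigD1 i) //= [X in _ + X]big1 => [|j /negPf ji].
  rewrite addr0 eqxx big_ord1.
  by rewrite conform_mx_id.
by rewrite ji big_ord0.
Qed.

End QuadraticModule.

Section SymmetrizedModule.

Variables (R : realType) (n r m p : nat) (q : 'I_m -> nat).
Variable G : forall i : 'I_m, 'M[polyxl R n r]_(q i).
Notation P := (polyx R n).
Notation V := ('M[P]_p * {ffun 'I_r -> 'M[P]_p})%type.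

(* Working on all coefficient tuples and testing membership after symmetrization
   avoids a type of symmetric tuples: the skew ones lie in the cone together with their
   opposites, so a functional nonnegative on it only sees the symmetric part. *)
Definition sym_qmodule (v : V) :=
  qmodule G (pencil v.1 v.2 + (pencil v.1 v.2)^T).

Lemma sym_qmodule_quadratic : quadratic_cone sym_qmodule.
Proof.
split=> [v w hv hw|a v hv]; rewrite /sym_qmodule.
  have -> : pencil (v + w).1 (v + w).2 = pencil v.1 v.2 + pencil w.1 w.2.
    by rewrite -pencilD; apply: eq_pencil => k; rewrite ffunE.
  rewrite trmxD addrACA; exact: (qmoduleD hv hw).
have -> : pencil (a ^+ 2 *: v).1 (a ^+ 2 *: v).2 = mpolyC r (a ^+ 2) *: pencil v.1 v.2.
  by rewrite -pencilZ; apply: eq_pencil => k; rewrite ffunE.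
by rewrite trmxZ -scalerDr; exact: (qmodule_sqr a hv).
Qed.

Lemma sym_qmodule_archimedean :
  restricted_archimedean G p -> archimedean_unit sym_qmodule (1%:M, 0).
Proof.
move=> harch.
have pen1 : pencil (1%:M : 'M[P]_p) (0 : {ffun 'I_r -> 'M[P]_p}) = 1%:M.
  by rewrite -(mpolyC1 r) -pencil_scalar; apply: eq_pencil => k; rewrite ffunE.
split=> [|v].
  have h1 : qmodule G (1%:M : 'M_p).
    have := qmodule_sos G (1%:M : 'M[P]_p); congr qmodule.
    by rewrite trmx1 mulmx1 /lift_mx map_mx1.
  by rewrite /sym_qmodule pen1 trmx1; exact: (qmoduleD h1 h1).
have [|c [c0 hc _]] := harch (pencil v.1 v.2 + (pencil v.1 v.2)^T).
  rewrite pencilT -pencilD; apply: pencil_in_SV => [|k].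
    by rewrite linearD /= trmxK addrC.
  by rewrite linearD /= trmxK addrC.
(* Symmetrization doubles the unit, so half of the constant suffices. *)
exists (c / 2); split; first lra.
rewrite /sym_qmodule.
have -> : pencil ((c / 2)%:A *: ((1%:M, 0) : V) + v).1 ((c / 2)%:A *: ((1%:M, 0) : V) + v).2 =
    (mpolyC r (mpolyC n (c / 2)))%:M + pencil v.1 v.2.
  rewrite -pencil_scalar -pencilD -mul_mpolyC mulr1 /= scalemx1.
  by apply: eq_pencil => k; rewrite !ffunE scaler0.
rewrite [(_ + _)^T]linearD /= tr_scalar_mx addrACA.
have c2 : c = c / 2 + c / 2 by lra.
by move: hc; rewrite {1}c2 !raddfD.
Qed.

Lemma sym_qmodule_of_qmodule (v : V) :
  v.1^T = v.1 -> (forall k, (v.2 k)^T = v.2 k) ->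
  qmodule G (pencil v.1 v.2) -> sym_qmodule v.
Proof.
move=> s0 s h; rewrite /sym_qmodule.
by rewrite pencilT s0 (eq_pencil _ s); exact: (qmoduleD h h).
Qed.

Lemma qmodule_of_sym_qmodule (v : V) :
  (pencil v.1 v.2)^T = pencil v.1 v.2 -> sym_qmodule v -> qmodule G (pencil v.1 v.2).
Proof.
rewrite /sym_qmodule => -> h.
(* Symmetrizing has doubled the pencil; the factor 1/2 is removed as a square. *)
have := qmodule_sqr (mpolyC n (Num.sqrt 2^-1)) h.
congr qmodule; rewrite -rmorphXn /= sqr_sqrtr ?invr_ge0 ?ler0n //.
have half : 2^-1 + 2^-1 = 1 :> R by lra.
by rewrite scalerDr -scalerDl -!mpolyCD half !mpolyC1 scale1r.
Qed.

End SymmetrizedModule.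

(** * Functionals on pencils and matrix points *)

Section Evaluation.

Variables (R : realType) (n : nat) (x : 'I_n -> R).
Notation P := (polyx R n).

Definition const_poly_mx a b (H : 'M[R]_(a, b)) : 'M[P]_(a, b) := map_mx (@mpolyC n R) H.

Lemma eval_mx_congr a b (X : 'M[P]_a) (H : 'M[R]_(a, b)) :
  eval_mx x ((const_poly_mx H)^T *m X *m const_poly_mx H) = H^T *m eval_mx x X *m H.
Proof.
have e : map_mx (meval x) (const_poly_mx H) = H.
  by apply/matrixP => i j; rewrite !mxE mevalC.
by rewrite /eval_mx !map_mxM -map_trmx e.
Qed.

(** Such a functional is determined by its values on the matrix units; their indices are exchanged
    so that the expansion is a trace. *)
Lemma mx_functional (p : nat) (psi : 'M[P]_p -> R) :
  {morph psi : X Y / X + Y} -> (forall a X, psi (a *: X) = a.@[x] * psi X) ->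
  forall X, psi X = \tr (eval_mx x X *m \matrix_(i, j) psi (delta_mx j i)).
Proof.
move=> psiD psiZ X.
have psi0 : psi 0 = 0 by apply: (addrI (psi 0)); rewrite -psiD !addr0.
rewrite {1}[X]matrix_sum_delta (big_morph psi psiD psi0); apply: eq_bigr => i _.
rewrite (big_morph psi psiD psi0) [RHS]mxE; apply: eq_bigr => j _.
by rewrite psiZ !mxE.
Qed.

Variable r : nat.
Notation V p := ('M[P]_p * {ffun 'I_r -> 'M[P]_p})%type.

Lemma pencil_functional (p : nat) (L : V p -> R) :
  (forall v w, L (v + w) = L v + L w) -> (forall a v, L (a *: v) = a.@[x] * L v) ->
  (forall v : V p, L (v.1^T, [ffun k => (v.2 k)^T]) = L v) ->
  exists (B0 : 'M[R]_p) (B : 'I_r -> 'M[R]_p), [/\ B0^T = B0, forall k, (B k)^T = B k &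
    forall v : V p, L v = \tr (eval_mx x v.1 *m B0) + \sum_(k < r) \tr (eval_mx x (v.2 k) *m B k)].
Proof.
move=> LD LZ LT.
have L0 : L 0 = 0 by apply: (addrI (L 0)); rewrite -LD !addr0.
pose inj0 X : V p := (X, 0).
pose inj k X : V p := (0, [ffun l => if l == k then X else 0]).
have [B0 hB0] : exists B0, forall X, L (inj0 X) = \tr (eval_mx x X *m B0).
  exists (\matrix_(i, j) L (inj0 (delta_mx j i))).
  apply: (@mx_functional _ (fun X => L (inj0 X))) => [X Y|a X]; last first.
    by rewrite -LZ; congr L; congr pair; rewrite scaler0.
  by rewrite -LD; congr L; congr pair; rewrite addr0.
have [B hB] : exists B : 'I_r -> 'M[R]_p, forall k X, L (inj k X) = \tr (eval_mx x X *m B k).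
  exists (fun k => \matrix_(i, j) L (inj k (delta_mx j i))) => k.
  apply: (@mx_functional _ (fun X => L (inj k X))) => [X Y|a X].
    rewrite -LD; congr L; congr pair; first by rewrite addr0.
    by apply/ffunP => l; rewrite !ffunE; case: eqP => // _; rewrite addr0.
  rewrite -LZ; congr L; congr pair; first by rewrite scaler0.
  by apply/ffunP => l; rewrite !ffunE; case: eqP => // _; rewrite scaler0.
have LE v : L v = \tr (eval_mx x v.1 *m B0) + \sum_(k < r) \tr (eval_mx x (v.2 k) *m B k).
  have {1}-> : v = inj0 v.1 + \sum_(k < r) inj k (v.2 k).
    rewrite [LHS]surjective_pairing; congr pair.
      by rewrite /= (big_morph fst (fun _ _ => erefl) erefl) big1 ?addr0.
    rewrite /= (big_morph snd (fun _ _ => erefl) erefl) add0r.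
    apply/ffunP => l; rewrite sum_ffunE (bigD1 l) //= ffunE eqxx big1 ?addr0 //.
    by move=> k kl; rewrite ffunE eq_sym (negPf kl).
  rewrite LD hB0 (big_morph L LD L0); congr (_ + _).
  by apply: eq_bigr => k _; rewrite hB.
(* Invariance of [L] under transposition allows the representing matrices to be replaced by their
   symmetric parts. *)
exists (2^-1 *: (B0 + B0^T)), (fun k => 2^-1 *: (B k + (B k)^T)).
have symm (X : 'M[R]_p) : (2^-1 *: (X + X^T))^T = 2^-1 *: (X + X^T).
  by rewrite [LHS]linearZ /= [(_ + _)^T]linearD /= trmxK addrC.
split=> // v.
have trT (X : 'M[P]_p) (Y : 'M[R]_p) : \tr (eval_mx x X^T *m Y) = \tr (eval_mx x X *m Y^T).
  by rewrite -mxtrace_tr trmx_mul /eval_mx -map_trmx trmxK mxtrace_mulC.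
have half (X Y : 'M[R]_p) :
    \tr (X *m (2^-1 *: (Y + Y^T))) = 2^-1 * (\tr (X *m Y) + \tr (X *m Y^T)).
  by rewrite -scalemxAr linearZ /= mulmxDr linearD.
rewrite half; under eq_bigr => k _ do rewrite half.
rewrite -big_distrr big_split /= -mulrDr addrACA -LE.
have := LT v; rewrite LE /= trT; under eq_bigr => k _ do rewrite ffunE trT.
move=> ->; lra.
Qed.

End Evaluation.

(** * Moment matrices of a separating functional *)

Section Moments.

Variables (R : realType) (n r m p : nat) (q : 'I_m -> nat).
Variable G : forall i : 'I_m, 'M[polyxl R n r]_(q i).
Notation P := (polyx R n).
Notation V := ('M[P]_p * {ffun 'I_r -> 'M[P]_p})%type.
Notation lift M := (lift_mx r M).

(** [Y0] and [Y k] act as matrix moments of 1 and [lambda k] at the point [x]. *)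
Definition pencil_pairing (x : 'I_n -> R) d (M0 : 'M[P]_d) (M : 'I_r -> 'M[P]_d)
    (Y0 : 'M[R]_d) (Y : 'I_r -> 'M[R]_d) : R :=
  \tr (eval_mx x M0 *m Y0) + \sum_(k < r) \tr (eval_mx x (M k) *m Y k).

(** The last clause lets the size [d] vary so that one positivity statement serves for squares
    ([d = 1]), for the Archimedean bounds ([d = p]) and for the generators ([d = q i]). The constant
    factor [H] is moved from the pencil to the moments by cyclicity of the trace. *)
Lemma separating_moments (F0 : 'M[P]_p) (F : 'I_r -> 'M[P]_p) :
  restricted_archimedean G p -> (pencil F0 F)^T = pencil F0 F -> ~ qmodule G (pencil F0 F) ->
  exists (x : 'I_n -> R) (B0 : 'M[R]_p) (B : 'I_r -> 'M[R]_p),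
  [/\ B0^T = B0 /\ (forall k, (B k)^T = B k), \tr B0 = 1, pencil_pairing x F0 F B0 B <= 0 &
      forall d (M0 : 'M[P]_d) (M : 'I_r -> 'M[P]_d) (H : 'M[R]_(d, p)),
      (pencil M0 M)^T = pencil M0 M ->
      qmodule G ((lift (const_poly_mx n H))^T *m pencil M0 M *m lift (const_poly_mx n H)) ->
      0 <= pencil_pairing x M0 M (H *m B0 *m H^T) (fun k => H *m B k *m H^T)].
Proof.
move=> harch sF nF.
pose u : V := (1%:M, 0); pose f : V := (F0, [ffun k => F k]).
have penf : pencil f.1 f.2 = pencil F0 F by apply: eq_pencil => k; rewrite ffunE.
have nf : ~ sym_qmodule G f.
  by move=> h; apply: nF; rewrite -penf; apply: qmodule_of_sym_qmodule; rewrite ?penf.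
have [L [[LD LZ] Lu Lge0 Lf Lmul]] :=
  quadratic_cone_separation (sym_qmodule_quadratic p G) (sym_qmodule_archimedean harch) nf.
pose x i := L ('X_i *: u).
have Lchar a : L (a *: u) = a.@[x].
  apply: (@mpoly_character R n (fun a => L (a *: u))) => [b c|b c|c].
  - by rewrite scalerDl LD.
  - by rewrite -scalerA Lmul.
  - by rewrite LZ Lu mulr1.
have L0 : L 0 = 0 by apply: (addrI (L 0)); rewrite -LD !addr0.
have LN v : L (- v) = - L v by apply/eqP; rewrite -addr_eq0 -LD addNr L0.
have LT (v : V) : L (v.1^T, [ffun k => (v.2 k)^T]) = L v.
  pose w : V := (v.1^T, [ffun k => (v.2 k)^T]).
  (* The difference of a tuple and its transpose symmetrizes to 0, which is in the module;
     exchanging the two gives the opposite inequality. *)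
  have skew (v' w' : V) : w'.1 = v'.1^T -> (forall k, w'.2 k = (v'.2 k)^T) ->
      L w' <= L v'.
    move=> e0 e; rewrite -subr_ge0 -LN -LD; apply: Lge0; rewrite /sym_qmodule.
    have eT : pencil w'.1 w'.2 = (pencil v'.1 v'.2)^T.
      by rewrite pencilT e0; apply: eq_pencil.
    have -> : pencil (v' - w').1 (v' - w').2 = pencil v'.1 v'.2 - (pencil v'.1 v'.2)^T.
      by rewrite -eT -pencilB; apply: eq_pencil => k; rewrite !ffunE.
    move: (pencil v'.1 v'.2) => X; rewrite trmxD trmxN trmxK -[X^T - X]opprB subrr.
    have := qmodule_sos G (0 : 'M[P]_(1, p)).
    by rewrite mulmx0 /lift_mx map_mx0.
  have w2 k : w.2 k = (v.2 k)^T by rewrite ffunE.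
  have v2 k : v.2 k = (w.2 k)^T by rewrite w2 trmxK.
  have le1 : L w <= L v := skew v w erefl w2.
  have le2 : L v <= L w := skew w v (esym (trmxK v.1)) v2.
  by rewrite -[LHS]/(L w); apply: le_anti; rewrite le1 le2.
have [|B0 [B [sB0 sB LE]]] := @pencil_functional R n x r p L LD _ LT.
  by move=> a v; rewrite Lmul Lchar.
exists x, B0, B; split; first by split.
- rewrite -Lu LE /= big1 ?addr0 => [|k _]; last first.
    by rewrite ffunE /eval_mx map_mx0 mul0mx mxtrace0.
  by rewrite /eval_mx map_mx1 mul1mx.
- by move: Lf; rewrite LE /pencil_pairing /=; under eq_bigr => k _ do rewrite ffunE.
move=> d M0 M H; rewrite pencilT => /pencil_inj [sM0 sM] hq.
set h := const_poly_mx n H in hq.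
pose v : V := (h^T *m M0 *m h, [ffun k => h^T *m M k *m h]).
have ev : pencil v.1 v.2 = (lift h)^T *m pencil M0 M *m lift h.
  by rewrite -pencil_congr; apply: eq_pencil => k; rewrite ffunE.
have : sym_qmodule G v.
  apply: sym_qmodule_of_qmodule => [|k|].
  - by rewrite !trmx_mul trmxK sM0 mulmxA.
  - by rewrite ffunE !trmx_mul trmxK sM mulmxA.
  - by rewrite ev.
move=> /Lge0; rewrite LE /pencil_pairing /= eval_mx_congr.
have cyc (X : 'M[R]_d) (Y : 'M[R]_p) : \tr (H^T *m X *m H *m Y) = \tr (X *m (H *m Y *m H^T)).
  by rewrite -2!mulmxA mxtrace_mulC !mulmxA.
by rewrite cyc; under eq_bigr => k _ do rewrite ffunE eval_mx_congr cyc.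
Qed.

(** Positivity on the square [w w^T] gives [psd B0]. The bounds come from some
    [(c + s lambda_k) I_p] in the module: its congruence to [(c + s lambda_k) w w^T] is paired with
    the moments. *)
Lemma separating_moments_dominated (x : 'I_n -> R) (B0 : 'M[R]_p) (B : 'I_r -> 'M[R]_p) :
  restricted_archimedean G p -> B0^T = B0 -> (forall k, (B k)^T = B k) -> \tr B0 = 1 ->
  (forall d (M0 : 'M[P]_d) (M : 'I_r -> 'M[P]_d) (H : 'M[R]_(d, p)),
    (pencil M0 M)^T = pencil M0 M ->
    qmodule G ((lift (const_poly_mx n H))^T *m pencil M0 M *m lift (const_poly_mx n H)) ->
    0 <= pencil_pairing x M0 M (H *m B0 *m H^T) (fun k => H *m B k *m H^T)) ->
  psd B0 /\ forall (s : R) k, exists c : R, psd (c *: B0 + s *: B k).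
Proof.
move=> harch sB0 sB trB0 hL; split.
  split=> // w; have := hL 1 1%:M (fun=> 0) w^T; rewrite pencil_scalar tr_scalar_mx.
  move=> /(_ erefl); rewrite mpolyC1 mulmx1 -lift_mxT -lift_mxM => /(_ (qmodule_sos _ _)).
  rewrite /pencil_pairing big1 => [|k _]; last by rewrite /eval_mx map_mx0 mul0mx mxtrace0.
  by rewrite addr0 /eval_mx map_mx1 mul1mx trmxK trace_mx11.
(* Trace one excludes [p = 0], so a basis vector is available to build [T]. *)
move=> s k; have [i0 _] : exists i0 : 'I_p, True.
  have [p0|p0] := posnP p; last by exists (Ordinal p0).
  have : \tr B0 = 0.
    by rewrite /mxtrace big1 // => i; have := ltn_ord i; rewrite [X in (_ < X)%N]p0.
  by rewrite trB0 => /eqP; rewrite oner_eq0.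
pose M l : 'M[P]_p := if l == k then (mpolyC n s)%:M else 0.
have sM l : (M l)^T = M l by rewrite /M; case: ifP => _; rewrite ?tr_scalar_mx ?trmx0.
have [|c [c0 hc _]] := harch (pencil 0 M); first by apply: pencil_in_SV; rewrite ?trmx0.
have ec : (mpolyC r (mpolyC n c))%:M + pencil 0 M = pencil (mpolyC n c)%:M M.
  by rewrite -pencil_scalar -pencilD addr0; apply: eq_pencil => l; rewrite add0r.
exists c; split; first by rewrite trmxD !trmxZ sB0 sB.
(* The congruence by [T] turns [I] into [w w^T]. *)
move=> w; pose T : 'M[R]_p := delta_mx i0 0 *m w^T.
have := hL p (mpolyC n c)%:M M T.
rewrite pencilT tr_scalar_mx (eq_pencil _ sM) => /(_ erefl).
rewrite -ec => /(_ (qmodule_congr _ hc)).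
have trT (Y : 'M[R]_p) : \tr (T *m Y *m T^T) = (w^T *m Y *m w) 0 0.
  rewrite /T trmx_mul trmxK -!mulmxA mxtrace_mulC -!mulmxA trmx_delta mul_delta_mx.
  have -> : delta_mx 0 0 = 1%:M :> 'M[R]_1.
    by apply/matrixP => i j; rewrite !ord1 !mxE.
  by rewrite mulmx1 trace_mx11.
have ev a : eval_mx x ((mpolyC n a)%:M : 'M_p) = a%:M by rewrite /eval_mx map_scalar_mx /= mevalC.
rewrite /pencil_pairing ev mul_scalar_mx mxtraceZ trT (bigD1 k) //= big1 => [|l lk].
  rewrite addr0 /M eqxx ev mul_scalar_mx mxtraceZ trT.
  rewrite mulmxDr mulmxDl -!scalemxAr -!scalemxAl.
  by rewrite [X in _ -> 0 <= X]mxE [X in _ -> 0 <= X + _]mxE [X in _ -> 0 <= _ + X]mxE.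
by rewrite /M (negPf lk) /eval_mx map_mx0 mul0mx mxtrace0.
Qed.

End Moments.

(** Links matrix points with moments: a vector [v], read as a matrix [K], turns the tuple [A] into
    the moments [K K^T] and [K (A k) K^T]. *)
Lemma pencil_eval_quadratic_form (R : realType) (n r d s : nat) (G0 : 'M[polyx R n]_d)
    (G : 'I_r -> 'M[polyx R n]_d) x (A : 'I_r -> 'M[R]_s) (v : 'cV_(d * s)) :
  (forall k, (A k)^T = A k) ->
  (v^T *m pencil_eval G0 G x A *m v) 0 0 =
  pencil_pairing x G0 G (unvec v *m (unvec v)^T) (fun k => unvec v *m A k *m (unvec v)^T).
Proof.
move=> sA; rewrite /pencil_eval mulmxDr mulmxDl mxE tens_quadratic_form trmx1 mulmx1.
congr (_ + _); rewrite mulmx_sumr mulmx_suml summxE; apply: eq_bigr => k _.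
by rewrite tens_quadratic_form sA.
Qed.

Lemma pencil_eval_sym (R : realType) (n r d s : nat) (G0 : 'M[polyx R n]_d)
    (G : 'I_r -> 'M[polyx R n]_d) x (A : 'I_r -> 'M[R]_s) :
  (pencil G0 G)^T = pencil G0 G -> (forall k, (A k)^T = A k) ->
  (pencil_eval G0 G x A)^T = pencil_eval G0 G x A.
Proof.
rewrite pencilT => /pencil_inj [s0 s1] sA.
have evT (X : 'M[polyx R n]_d) : (eval_mx x X)^T = eval_mx x X^T by rewrite /eval_mx map_trmx.
rewrite /pencil_eval trmxD trmx_tens trmx1 evT s0; congr (_ + _).
rewrite linear_sum; apply: eq_bigr => k _ /=.
by rewrite trmx_tens evT s1 sA.
Qed.

Theorem theorem6p6 (R : realType) (n r p m : nat)
    (q : 'I_m -> nat)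
    (F0 : 'M[polyx R n]_p) (F : 'I_r -> 'M[polyx R n]_p)
    (G0 : forall i : 'I_m, 'M[polyx R n]_(q i))
    (G : forall i : 'I_m, 'I_r -> 'M[polyx R n]_(q i))
    (hF : (pencil F0 F)^T = pencil F0 F)
    (hG : forall i : 'I_m, (pencil (G0 i) (G i))^T = pencil (G0 i) (G i))
    (harch : restricted_archimedean (fun i : 'I_m => pencil (G0 i) (G i)) p)
    (hpos : exists eps : R, 0 < eps /\
       forall (s : nat) (x : 'I_n -> R) (A : 'I_r -> 'M[R]_s),
         (0 < s)%N ->
         (forall k : 'I_r, (A k)^T = A k) ->
         (forall i : 'I_m, loewner_le 0 (pencil_eval (G0 i) (G i) x A)) ->
         loewner_le eps%:M (pencil_eval F0 F x A)) :
  qmodule (fun i : 'I_m => pencil (G0 i) (G i)) (pencil F0 F).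
Proof.
apply: boolp.contrapT => nF; have [eps [eps0 hA]] := hpos.
have [x [B0 [B [[sB0 sB] trB0 leF hL]]]] := separating_moments harch hF nF.
have [pB0 dom] := separating_moments_dominated harch sB0 sB trB0 hL.
have [|k|s [C [D [A [eB0 eD sA eB]]]]] := psd_dominated_factor pB0 sB.
- by move=> k; have [c] := dom 1 k; rewrite scale1r; exists c.
- by have [c] := dom (- 1) k; rewrite scaleN1r; exists c.
(* A factorization through size 0 would give [B0] trace 0. *)
have s0 : (0 < s)%N.
  rewrite lt0n; apply/eqP => s0; move/eqP: trB0; rewrite eB0 mxtrace_mulC /mxtrace big1.
    by rewrite eq_sym oner_eq0.
  by move=> i; have := ltn_ord i; rewrite [X in (_ < X)%N]s0.
have : loewner_le eps%:M (pencil_eval F0 F x A).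
  apply: hA => // i; rewrite /loewner_le subr0; split; first exact: pencil_eval_sym.
  move=> v; rewrite [X in 0 <= X]pencil_eval_quadratic_form //.
  (* With [H = unvec v *m D], the relation [D C = 1] cancels the factor [C] of the moments and
     leaves those attached to [v]. *)
  have := hL (q i) (G0 i) (G i) (unvec v *m D) (hG i) (qmodule_gen _ _).
  have CD (Y : 'M[R]_s) : unvec v *m D *m (C *m Y *m C^T) *m (unvec v *m D)^T =
      unvec v *m Y *m (unvec v)^T.
    rewrite trmx_mul !mulmxA -(mulmxA (unvec v) D C) eD mulmx1 -(mulmxA _ C^T D^T).
    by rewrite -trmx_mul eD trmx1 mulmx1.
  have := CD 1%:M; rewrite !mulmx1 -eB0 => CD1.
  by rewrite /pencil_pairing CD1; under eq_bigr => k _ do rewrite eB CD.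
(* At [vec C] the associated moments are [B0] and [B], and the squared norm is the trace of [B0],
   which is 1. *)
case=> _ /(_ (vec C)); rewrite mulmxBr mulmxBl mul_mx_scalar -scalemxAl.
rewrite [X in 0 <= X]mxE [X in 0 <= X + _]pencil_eval_quadratic_form // vecK.
have -> : pencil_pairing x F0 F (C *m C^T) (fun k => C *m A k *m C^T) =
    pencil_pairing x F0 F B0 B.
  by rewrite /pencil_pairing eB0; under [in RHS]eq_bigr => k _ do rewrite eB.
have -> : (- (eps *: ((vec C)^T *m vec C))) 0 0 = - eps.
  by rewrite mxE [X in - X]mxE vec_norm -eB0 trB0 mulr1.
lra.
Qed.
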